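(* Let $b:\mathbb{D}\to\mathbb{D}$ be analytic and let $\Omega$ be an approach region at $1$. If the kernels $k^b_z$ converge in the norm of $\mathcal{H}(b)$ (to the boundary kernel $k^b_1$) as $z\to1$ in $\Omega$, then the limits $b'(1)=\lim_{z\to1,\,z\in\Omega}b'(z)$ and $b(1)=\lim_{z\to1,\,z\in\Omega}b(z)$ exist, and $|b(1)|=1$.
   Context: $\mathcal{H}(b)$ is the reproducing kernel Hilbert space of analytic functions on the unit disk $\mathbb{D}$ with reproducing kernel $k^b_z(w)=\frac{1-\overline{b(z)}b(w)}{1-\overline{z}w}$. An approach region at $1$ is an open simply connected domain $\Omega\subset\mathbb{D}$ with $\partial\Omega\cap\mathbb{T}=\{1\}$ such that for all $z\in\Omega$ sufficiently close to $1$ the segment between $z$ and $1$ lies in $\Omega$. *)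

(* Defs.v *)
(* Complex numbers are  R[i]  for  R : realType
   (mathcomp-real-closed's complex.v), equipped with the modulus-norm
   topology of the numFieldType R[i] viewed as a normed module over itself,
   so that  derivable f z 1  /  'D_1 f z  is the complex derivative. *)
From HB Require Import structures.
From mathcomp Require Import all_boot all_order all_algebra.
From mathcomp Require Import all_classical all_reals all_analysis.
From mathcomp Require Import complex.
Export ComplexField.
Import Order.TTheory GRing.Theory Num.Theory numFieldNormedType.Exports.

Set Implicit Arguments.
Unset Strict Implicit.
Unset Printing Implicit Defensive.

Local Open Scope ring_scope.
Local Open Scope classical_set_scope.

(* C = R[i] as a normed module over itself (the standard metric on C). *)
HB.instance Definition _ (R : realType) :=
  NormedModule.copy R[i] (R[i] : numFieldType)^o.

Section Defs.
Variable R : realType.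
Local Notation C := R[i].

(* the open unit disk D *)
Definition disk : set C := [set z | `|z| < 1].

(* the unit circle T *)
Definition circle : set C := [set z | `|z| = 1].

(* the real number t viewed as a complex number *)
Definition RtoC (t : R) : C := (t +i* 0)%C.

(* f is analytic (holomorphic: complex differentiable) at every point of A *)
Definition holomorphic_on (f : C -> C) (A : set C) : Prop :=
  forall z, A z -> derivable f z 1.

(* de Branges-Rovnyak kernel:  hb_kernel b w z = k^b_w(z)
   = (1 - conj(b w) b z) / (1 - conj(w) z). *)
Definition hb_kernel (b : C -> C) (w z : C) : C :=
  (1 - (b w)^* * b z) / (1 - w^* * z).

(* L : D x D -> C is a positive (semidefinite) kernel on D *)
Definition pos_kernel (L : C -> C -> C) : Prop :=
  forall (n : nat) (z : 'I_n -> C) (c : 'I_n -> C),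
    (forall i, disk (z i)) ->
    0 <= \sum_(i < n) \sum_(j < n) (c i)^* * c j * L (z i) (z j).

(* The H(b) norm (RKHS of the kernel K(x,y) = k^b_y(x), via Aronszajn):
   f : D -> C belongs to H(b) with ||f||_{H(b)} <= r  iff
   r^2 K(x,y) - f(x) conj(f(y)) is a positive kernel on D. *)
Definition hb_norm_le (b : C -> C) (f : C -> C) (r : R) : Prop :=
  0 <= r /\
  pos_kernel (fun x y => RtoC (r ^+ 2) * hb_kernel b y x - f x * (f y)^*).

(* Simple connectivity: connected, nonempty, and every closed loop in A
   (parametrized by [0,1]) is freely homotopic in A, through closed loops,
   to a constant loop. *)
Definition simply_connected (A : set C) : Prop :=
  A !=set0 /\ connected A /\
  forall g : R -> C,
    {within `[0, 1], continuous g} ->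
    (forall t, t \in `[0, 1] -> A (g t)) ->
    g 0 = g 1 ->
    exists H : R * R -> C,
      [/\ {within `[0, 1] `*` `[0, 1], continuous H},
          (forall s t, s \in `[0, 1] -> t \in `[0, 1] -> A (H (s, t))),
          (forall t, t \in `[0, 1] -> H (0, t) = g t),
          (exists c, forall t, t \in `[0, 1] -> H (1, t) = c) &
          (forall s, s \in `[0, 1] -> H (s, 0) = H (s, 1))].

(* Approach region at 1. *)
Definition approach_region (Om : set C) : Prop :=
  [/\ open Om,
      Om `<=` disk,
      simply_connected Om,
      (closure Om `\` Om) `&` circle = [set 1] &
      \forall z \near (1 : C), Om z ->
         forall t : R, 0 <= t < 1 -> Om (RtoC (1 - t) * z + RtoC t)].

End Defs.

(* Main.v *)
Require Import Defs.
From HB Require Import structures.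
From mathcomp Require Import all_boot all_order all_algebra.
From mathcomp Require Import all_classical all_reals all_analysis.
From mathcomp Require Import complex ring lra.
Import ComplexField Normc.
Import Order.TTheory GRing.Theory Num.Theory numFieldNormedType.Exports.
Local Open Scope ring_scope.
Local Open Scope classical_set_scope.

Set Implicit Arguments.
Unset Strict Implicit.
Unset Printing Implicit Defensive.

(* A norm bound [hb_norm_le b f r] with [r > 0] makes the kernel of H(b)
   positive, so Schwarz-Pick is the Cauchy-Schwarz inequality for two kernels.
   Norm convergence makes the kernels [k_z] bounded near 1, whence |b(z)| -> 1;
   the pointwise limits of [k_z] then give b(z) -> b1, together with the formula
   k1(w) = (1 - conj b1 b(w)) / (1 - w), and the norms |k_z|^2 converge to some
   kap. For the derivative, the norm of the derivative-evaluation functional at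
   [z] is O(1 / (1 - |z|^2)), because |k_u - k_z| is at most a constant times
   |u - z| / (1 - |z|^2) for [u] close to [z]. Applied to [k_z - k1], whose norm
   tends to 0, this gives b'(z) -> kap b1, however tangential the approach. *)

(** * The real-valued modulus of a complex number *)

Section Modulus.
Variable R : realType.
Implicit Types (x y z : R[i]) (r : R).

Lemma normc_ge0 z : 0 <= normc z.
Proof. by case: z => a c; apply: sqrtr_ge0. Qed.

Lemma normc_gt0 z : (0 < normc z) = (z != 0).
Proof. by rewrite -normr_gt0 -[in RHS]/(0 < (normc z)%:C%C) ltcR. Qed.

Lemma normc_conj z : normc z^* = normc z.
Proof. by case: z => a c; rewrite /normc /= sqrrN. Qed.

Lemma normc_sqr z : (normc z ^+ 2)%:C%C = z * z^*.
Proof. by rewrite rmorphXn -normCK. Qed.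

Lemma normc_mul z : (normc z)%:C%C * (normc z)%:C%C = z * z^*.
Proof. by rewrite -normc_sqr rmorphXn. Qed.

Lemma normcB x y : normc (x - y) = normc (y - x).
Proof. by rewrite -(normcN (x - y)) opprB. Qed.

Lemma normc_triangle x y : normc (x - y) <= normc x + normc y.
Proof. by rewrite -(normcN y) le_normcD. Qed.

Lemma normc_dist_split x y z : normc (x - z) <= normc (x - y) + normc (y - z).
Proof. by apply: le_trans (le_normcD _ _); rewrite addrA subrK. Qed.

Lemma normc_realc r : normc r%:C%C = `|r|.
Proof. by rewrite /normc /= expr0n addr0 sqrtr_sqr. Qed.

Lemma normc_real r : 0 <= r -> normc r%:C%C = r.
Proof. by move=> r0; rewrite normc_realc ger0_norm. Qed.

Lemma ltc_norm z r : (`|z| < r%:C%C) = (normc z < r).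
Proof. exact: ltcR. Qed.

Lemma gt0_complexE (e : R[i]) :
  0 < e -> 0 < complex.Re e /\ e = (complex.Re e)%:C%C.
Proof. by case: e => a c; rewrite ltcE /= => /andP[/eqP -> a0]. Qed.

Lemma diskE z : @disk R z <-> normc z < 1.
Proof. by rewrite -ltc_norm. Qed.

Lemma disk_normc_sqr z : @disk R z -> normc z ^+ 2 < 1.
Proof. by move=> /diskE; rewrite expr_lt1 ?normc_ge0. Qed.

End Modulus.

(** * Positive kernels: point evaluation, Cauchy-Schwarz, Schwarz-Pick *)

Section Kernel.
Variables (R : realType) (b : R[i] -> R[i]).
Implicit Types (u w z : R[i]) (f : R[i] -> R[i]) (r : R).

Lemma pos_kernel_ge0_1 (L : R[i] -> R[i] -> R[i]) u :
  pos_kernel L -> @disk R u -> 0 <= L u u.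
Proof.
move=> posL Du; have := posL 1 (fun=> u) (fun=> 1) (fun=> Du).
by rewrite !big_ord1 rmorph1 !mul1r.
Qed.

Lemma pos_kernel_ge0_2 (L : R[i] -> R[i] -> R[i]) u z (c d : R[i]) :
  pos_kernel L -> @disk R u -> @disk R z ->
  0 <= c^* * c * L u u + c^* * d * L u z + (d^* * c * L z u + d^* * d * L z z).
Proof.
move=> posL Du Dz.
have := posL 2 (fun i => if i == 0 then u else z)
  (fun i => if i == 0 then c else d).
rewrite !big_ord_recl !big_ord0 /= !addr0; apply => i.
by case: ifP.
Qed.

Lemma disk_conj_neq0 w z : @disk R w -> @disk R z -> 1 - w^* * z != 0.
Proof.
move=> /diskE Dw /diskE Dz; apply/eqP => /eqP; rewrite subr_eq0 => /eqP e.
have : normc (w^* * z) = 1 by rewrite -e normc1.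
rewrite normcM normc_conj; have := normc_ge0 w; have := normc_ge0 z; nra.
Qed.

(** The squared norm of k_z in H(b), that is k_z(z), kept in [R] so that it can enter order
    estimates. *)
Definition kdiag z : R := (1 - normc (b z) ^+ 2) / (1 - normc z ^+ 2).

Lemma hb_kernel_diag z : hb_kernel b z z = (kdiag z)%:C%C.
Proof.
rewrite /hb_kernel /kdiag rmorphM fmorphV !rmorphB rmorph1 /=.
by rewrite !normc_sqr ![_^* * _]mulrC.
Qed.

Lemma hb_kernelC w z : (hb_kernel b w z)^* = hb_kernel b z w.
Proof.
rewrite /hb_kernel rmorphM fmorphV !rmorphB !rmorphM rmorph1 /= !conjCK.
by rewrite [b w * _]mulrC [w * _]mulrC.
Qed.

Lemma realc_ge0 (r : R) : (0 <= r%:C%C) = (0 <= r).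
Proof. exact: lecR. Qed.

(** Positivity at one point; it stands for |<f, k_u>| <= |f| |k_u|. *)
Lemma hb_norm_le_eval f r u :
  hb_norm_le b f r -> @disk R u -> normc (f u) ^+ 2 <= r ^+ 2 * kdiag u.
Proof.
move=> [_ posL] Du; have := pos_kernel_ge0_1 posL Du.
rewrite hb_kernel_diag -normc_sqr /RtoC.
by rewrite -(rmorphM (real_complex R)) -rmorphB realc_ge0 subr_ge0.
Qed.

(* The distance between the kernels at [u] and [z] in H(b), squared. *)
Definition kdist2 u z : R :=
  kdiag u + kdiag z - 2 * complex.Re (hb_kernel b z u).

Lemma kdist2E u z : (kdist2 u z)%:C%C =
  hb_kernel b u u - hb_kernel b z u - hb_kernel b u z + hb_kernel b z z.
Proof.
rewrite /kdist2 !hb_kernel_diag -(hb_kernelC z u).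
case: (hb_kernel b z u) => x y; apply/eqP; rewrite eq_complex /=.
by apply/andP; split; apply/eqP; ring.
Qed.

(** Positivity at two points with coefficients 1 and -1; it stands for |<f, k_u - k_z>| <= |f| |k_u
    - k_z|. *)
Lemma hb_norm_le_diff f r u z : hb_norm_le b f r -> @disk R u -> @disk R z ->
  normc (f u - f z) ^+ 2 <= r ^+ 2 * kdist2 u z.
Proof.
move=> [_ posL] Du Dz; have := pos_kernel_ge0_2 1 (-1) posL Du Dz.
rewrite [X in 0 <= X](_ : _ = (r ^+ 2 * kdist2 u z - normc (f u - f z) ^+ 2)%:C%C).
  by rewrite realc_ge0 subr_ge0.
rewrite rmorphB /= normc_sqr rmorphM /= kdist2E /RtoC.
rewrite -[(r ^+ 2 +i* 0)%C]/((r ^+ 2)%:C%C).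
by rewrite !(rmorphB, rmorphN, rmorph1) /=; ring.
Qed.

Hypothesis bD : forall z, @disk R z -> @disk R (b z).

Lemma kdiag_gt0 z : @disk R z -> 0 < kdiag z.
Proof.
by move=> Dz; rewrite divr_gt0 ?subr_gt0 ?disk_normc_sqr //; apply: bD.
Qed.

(* [f] and [r] only serve to make the kernel positive: r^2 K >= f f^*. *)
Lemma hb_kernel_cauchy_schwarz f r u z : 0 < r -> hb_norm_le b f r ->
  @disk R u -> @disk R z ->
  normc (hb_kernel b z u) ^+ 2 <= kdiag u * kdiag z.
Proof.
move=> r0 [_ posL] Du Dz.
set t := hb_kernel b z u; set k := kdiag z.
(* These are the coefficients of [k] times the component of k_u orthogonal to k_z, a vector of
   squared norm k (k_u(u) k - |t|^2). *)
have := pos_kernel_ge0_2 k%:C%C (- t^*) posL Du Dz.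
set g := k%:C%C * (f u)^* - t^* * (f z)^*.
rewrite [X in 0 <= X](_ : _ =
  (r ^+ 2 * (k * (kdiag u * k - normc t ^+ 2)) - normc g ^+ 2)%:C%C).
  rewrite realc_ge0 subr_ge0 => le_g.
  rewrite -subr_ge0 -(pmulr_rge0 _ (kdiag_gt0 Dz)).
  rewrite -(pmulr_rge0 _ (exprn_gt0 2 r0)).
  by apply: le_trans le_g; rewrite sqr_ge0.
rewrite /RtoC -[(r ^+ 2 +i* 0)%C]/((r ^+ 2)%:C%C).
rewrite -(hb_kernelC z u) !hb_kernel_diag -/t -/k /g.
clear g posL Du Dz; move: t k (kdiag u) (f u) (f z) => t k A x y.
have kJ : (k%:C%C)^* = k%:C%C by apply: conjc_real.
rewrite !(rmorphB, rmorphM) /= !normc_mul.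
by rewrite !(rmorphN, rmorphB, rmorphM) /= !conjCK kJ; ring.
Qed.

(** Applied to the points and to the values of [b], it exposes the products of 1 - |.|^2 that occur
    in Cauchy-Schwarz. *)
Lemma schwarz_pick_identity (x y : R[i]) : normc (1 - x^* * y) ^+ 2 =
  (1 - normc x ^+ 2) * (1 - normc y ^+ 2) + normc (y - x) ^+ 2.
Proof.
apply: (@complexI R); rewrite !(rmorphD, rmorphN, rmorphM, rmorph1) /=.
by rewrite !normc_mul !(rmorphB, rmorphM, rmorph1) /= conjCK; ring.
Qed.

(** Let a and h be the squared distances of the values and of the points. Cauchy-Schwarz reads (A +
    a) / (B + h) <= A / B, with A and B the products of 1 - |.|^2 over the values and over the
    points. Cross-multiplying leaves a B <= h A, which is equivalent to the claim squared. *)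
Lemma schwarz_pick f r u z : 0 < r -> hb_norm_le b f r ->
  @disk R u -> @disk R z ->
  normc (b u - b z) <= normc (u - z) * normc (hb_kernel b z u).
Proof.
move=> r0 fr Du Dz.
rewrite -(@ler_pXn2r _ 2) ?nnegrE ?mulr_ge0 ?normc_ge0 // exprMn.
move: (hb_kernel_cauchy_schwarz r0 fr Du Dz).
rewrite /hb_kernel normcM normcV exprMn exprVn !schwarz_pick_identity /kdiag.
have := disk_normc_sqr Du; have := disk_normc_sqr Dz.
have := disk_normc_sqr (bD Du); have := disk_normc_sqr (bD Dz).
set P := normc (b z) ^+ 2; set Q := normc (b u) ^+ 2.
set p := normc z ^+ 2; set q := normc u ^+ 2.
have := sqr_ge0 (normc (b u - b z)); have := sqr_ge0 (normc (u - z)).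
set h := normc (u - z) ^+ 2; set a := normc (b u - b z) ^+ 2.
rewrite -!/(_ / _) => h0 a0 P1 Q1 p1 q1.
have pq0 : 0 < (1 - p) * (1 - q) by rewrite mulr_gt0 ?subr_gt0.
rewrite mulf_div ler_pdivrMr; last by lra.
rewrite mulrAC ler_pdivlMr; last by rewrite mulrC.
move=> le1; rewrite mulrA ler_pdivlMr; last by lra.
nra.
Qed.

End Kernel.

(** * Distance between two kernels in H(b) *)

Section KernelDistance.
Variables (R : realType) (b : R[i] -> R[i]).
Hypothesis bD : forall z, @disk R z -> @disk R (b z).
Implicit Types (u w z : R[i]) (f : R[i] -> R[i]) (r : R).

(** Free [c] and [d] cover both k_w (conj b(w) and conj w) and the boundary kernel (conj b1 and
    1). *)
Lemma cauchy_quotient_diff (c d x y u z : R[i]) :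
  1 - d * u != 0 -> 1 - d * z != 0 ->
  (1 - c * y) / (1 - d * u) - (1 - c * x) / (1 - d * z) =
  ((u - z) * d * ((1 - c * x) / (1 - d * z)) - (y - x) * c) / (1 - d * u).
Proof. by move=> du dz; field; rewrite du dz. Qed.

Lemma hb_kernel_diff w u z : @disk R w -> @disk R u -> @disk R z ->
  hb_kernel b w u - hb_kernel b w z =
  ((u - z) * w^* * hb_kernel b w z - (b u - b z) * (b w)^*) / (1 - w^* * u).
Proof. by move=> *; rewrite cauchy_quotient_diff ?disk_conj_neq0. Qed.

(** The defining sum of [kdist2] hides a cancellation: here every term on the right is of second
    order in u - z, the outer two because k_z(u) - k_z(z) is itself of first order. *)
Lemma kdist2_identity u z : @disk R u -> @disk R z ->
  ((1 - normc u ^+ 2) * kdist2 b u z + normc (b u - b z) ^+ 2)%:C%C =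
  (u - z)^* * z * (hb_kernel b z u - hb_kernel b z z) +
  (u - z) * (u - z)^* * hb_kernel b z u +
  (u - z) * u^* * (hb_kernel b z u - hb_kernel b z z)^*.
Proof.
move=> Du Dz.
rewrite rmorphD /= normc_sqr rmorphM rmorphB rmorph1 /= normc_sqr kdist2E.
rewrite [(hb_kernel b z u - _)^*]rmorphB /= !hb_kernelC.
have := disk_conj_neq0 Du Du; have := disk_conj_neq0 Dz Dz.
have := disk_conj_neq0 Du Dz; have := disk_conj_neq0 Dz Du.
rewrite /hb_kernel !(rmorphB _ u z) !(rmorphB _ (b u) (b z)) /=.
move: (b u) (b z) (b u)^* (b z)^* u^* z^* => bu bz bu' bz' u' z' n1 n2 n3 n4.
by field; rewrite n1 n2 n3 n4.
Qed.

(** Schwarz-Pick controls b(u) - b(z) in [hb_kernel_diff], so |k_z(u) - k_z(z)| is at most |u - z|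
    times the quotient shown. Both outer terms of [kdist2_identity] contribute it, hence the factor
    2. *)
Lemma kdist2_le f r u z : 0 < r -> hb_norm_le b f r ->
  @disk R u -> @disk R z ->
  (1 - normc u ^+ 2) * kdist2 b u z <=
  normc (u - z) ^+ 2 * (normc (hb_kernel b z u) +
    2 * ((kdiag b z + normc (hb_kernel b z u)) / normc (1 - z^* * u))).
Proof.
move=> r0 fr Du Dz; have sp := schwarz_pick bD r0 fr Du Dz.
have dtk : normc (hb_kernel b z u - hb_kernel b z z) <=
    normc (u - z) * ((kdiag b z + normc (hb_kernel b z u)) / normc (1 - z^* * u)).
  rewrite hb_kernel_diff // normcM normcV [leRHS]mulrA.
  rewrite ler_wpM2r ?invr_ge0 ?normc_ge0 //.
  rewrite (le_trans (normc_triangle _ _)) // mulrDr.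
  rewrite hb_kernel_diag [normc (_ * _%:C%C)]normcM [normc (_ * z^*)]normcM.
  rewrite [normc (_ * (b z)^*)]normcM !normc_conj normc_real; last first.
    exact/ltW/kdiag_gt0.
  have := diskE z; case=> /(_ Dz) z1 _; have := bD Dz => /diskE bz1.
  have := kdiag_gt0 bD Dz; have := normc_ge0 z; have := normc_ge0 (b z).
  have := normc_ge0 (u - z); have := normc_ge0 (b u - b z).
  move: sp z1 bz1; set h := normc (u - z); set a := normc (b u - b z).
  move=> sp z1 bz1 a0 h0 bz0 z0 k0; apply: lerD.
    by rewrite ler_wpM2r ?(ltW k0) // ler_piMr // ltW.
  by rewrite (le_trans _ sp) // ler_piMr // ltW.
have := kdist2_identity Du Dz => /(congr1 (@normc R)) e.
apply: (@le_trans _ _ ((1 - normc u ^+ 2) * kdist2 b u z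
  + normc (b u - b z) ^+ 2)); first by rewrite lerDl sqr_ge0.
rewrite (le_trans (ler_norm _)) // -normc_realc e; apply: le_trans (le_normcD _ _) _.
apply: le_trans (lerD (le_normcD _ _) (lexx _)) _.
move: {e sp} dtk; move: (hb_kernel b z u) (hb_kernel b z z) => t k dtk.
rewrite !normcM !normc_conj.
move: dtk Du Dz => + /diskE u1 /diskE z1.
have := normc_ge0 u; have := normc_ge0 z; have := normc_ge0 (u - z).
have := normc_ge0 (t - k).
set h := normc (u - z); set d := normc (_ - _); set A := _ / _.
move=> d0 h0 z0 u0 dA.
have : h * normc z * d <= h * d by rewrite ler_wpM2r // ler_piMr // ltW.
have : h * normc u * d <= h * d by rewrite ler_wpM2r // ler_piMr // ltW.
have : h * d <= h * (h * A) by rewrite ler_wpM2l.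
lra.
Qed.

End KernelDistance.

(** * Limits of complex functions along a filter *)

Section ComplexLimits.
Variables (R : realType) (T : Type) (F : set_system T).
Implicit Types (f g : T -> R[i]) (l : R[i]).

(** The norm of [R[i]] takes values in [R[i]]; real tolerances keep the later estimates in [R]. *)
Lemma cvg_normcP (FF : Filter F) f l : f x @[x --> F] --> l <->
  forall e : R, 0 < e -> \forall x \near F, normc (f x - l) < e.
Proof.
split=> [/cvgrPdist_lt fl e e0|fl].
  have : 0 < e%:C%C :> R[i] by rewrite ltcR.
  move=> /fl; apply: filterS => x; rewrite ltc_norm.
  by rewrite normcB.
apply/cvgrPdist_lt => e /gt0_complexE[e0 ->].
by apply: filterS (fl _ e0) => x; rewrite ltc_norm normcB.
Qed.

Lemma cvg_conj (FF : Filter F) f l :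
  f x @[x --> F] --> l -> (f x)^* @[x --> F] --> l^*.
Proof.
move=> /(cvg_normcP FF) fl; apply/(cvg_normcP FF) => e /fl.
by apply: filterS => x; rewrite -rmorphB normc_conj.
Qed.

Lemma cvg_normc (FF : Filter F) f l :
  f x @[x --> F] --> l -> normc (f x) @[x --> F] --> normc l.
Proof.
move=> /(cvg_normcP FF) fl; apply/cvgrPdist_lt => e /fl.
apply: filterS => x; apply: le_lt_trans.
have := normc_dist_split (f x) l 0; have := normc_dist_split l (f x) 0.
by rewrite !subr0 (normcB l) ler_norml => h1 h2; apply/andP; split; lra.
Qed.

Lemma normc_lim_le (FF : ProperFilter F) f l (B : R) :
  f x @[x --> F] --> l -> (\forall x \near F, normc (f x) <= B) ->
  normc l <= B.
Proof.
move=> /cvg_normc fl fB; rewrite leNgt; apply/negP => Bl.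
have [x []] := filter_ex (filterI fB (cvgr_gt _ fl _ Bl)).
by rewrite leNgt => /negP.
Qed.

End ComplexLimits.

(** * Derivative evaluation at an interior point *)

Section DerivativeBound.
Variables (R : realType) (b : R[i] -> R[i]) (z : R[i]).
Hypothesis bD : forall w, @disk R w -> @disk R (b w).
Hypothesis bz : derivable b z 1.
Hypothesis Dz : @disk R z.

Lemma derivable_quotient_cvg :
  (b (h + z) - b z) / h @[h --> (0 : R[i])^'] --> 'D_1 b z.
Proof.
have -> : (fun h : R[i] => (b (h + z) - b z) / h) =
    (fun h => h^-1 *: ((b \o shift z) (h *: 1) - b z)).
  apply/funext => h /=; rewrite mulrC.
  by rewrite -[h *: 1]/(h * 1) mulr1.
exact: bz.
Qed.

Lemma cvg_dnbhs0_id : h @[h --> (0 : R[i])^'] --> (0 : R[i]).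
Proof. exact: nbhs_dnbhs. Qed.

Lemma cvg_dnbhs0_shift : h + z @[h --> (0 : R[i])^'] --> z.
Proof.
rewrite -[X in _ --> X]add0r; apply: cvgD; last exact: cvg_cst.
exact: cvg_dnbhs0_id.
Qed.

Lemma derivable_shift_cvg : b (h + z) @[h --> (0 : R[i])^'] --> b z.
Proof.
have lim : (b (h + z) - b z) / h * h + b z @[h --> (0 : R[i])^'] -->
    'D_1 b z * 0 + b z.
  apply: cvgD; last exact: cvg_cst.
  apply: cvgM; [exact: derivable_quotient_cvg|exact: cvg_dnbhs0_id].
move: lim; rewrite mulr0 add0r; apply: cvg_trans; apply: near_eq_cvg.
near=> h; rewrite divfK ?subrK //.
by near: h; exact: nbhs_dnbhs_neq.
Unshelve. all: by end_near. Qed.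

Lemma hb_kernel_shift_cvg :
  hb_kernel b z (h + z) @[h --> (0 : R[i])^'] --> hb_kernel b z z.
Proof.
apply: cvgM.
  apply: cvgB; first exact: cvg_cst.
  by apply: cvgM; [exact: cvg_cst|exact: derivable_shift_cvg].
apply: cvgV; first exact: disk_conj_neq0.
apply: cvgB; first exact: cvg_cst.
by apply: cvgM; [exact: cvg_cst|exact: cvg_dnbhs0_shift].
Qed.

(** By continuity, the factors of [kdist2_le] at h + z are within a factor 2 of their values at [z].
    This yields the constant 28; 36 is the next square, and its root 6 enters [derivative_le]. *)
Lemma near_kdist2_le f r : 0 < r -> hb_norm_le b f r ->
  \forall h \near (0 : R[i])^', @disk R (h + z) /\
    kdist2 b (h + z) z <=
    normc h ^+ 2 * (36 * kdiag b z / (1 - normc z ^+ 2) ^+ 2).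
Proof.
move=> r0 fr; have z2 := disk_normc_sqr Dz; have k0 := kdiag_gt0 bD Dz.
set p := 1 - normc z ^+ 2; have p0 : 0 < p by rewrite subr_gt0.
have p1 : p <= 1 by rewrite gerBl sqr_ge0.
have cz := cvg_dnbhs0_shift.
have cn2 : normc (h + z) ^+ 2 @[h --> (0 : R[i])^'] --> normc z ^+ 2.
  exact: (cvgM (cvg_normc _ cz) (cvg_normc _ cz)).
have czz : 1 - z^* * (h + z) @[h --> (0 : R[i])^'] --> 1 - z^* * z.
  apply: cvgB; first exact: cvg_cst.
  by apply: cvgM; first exact: cvg_cst.
have pE : normc (1 - z^* * z) = p.
  by rewrite mulrC -normc_sqr -(rmorph1 (real_complex R)) -rmorphB normc_real ?ltW.
near=> h.
have Dh : @disk R (h + z).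
  apply/diskE; near: h; apply: (cvgr_lt _ (cvg_normc _ cz)).
  exact/diskE.
split=> //; have := kdist2_le bD r0 fr Dh Dz.
rewrite addrK.
have q2 : p / 2 < 1 - normc (h + z) ^+ 2.
  have : normc (h + z) ^+ 2 < 1 - p / 2.
    by near: h; apply: (cvgr_lt _ cn2); rewrite /p; lra.
  lra.
have s2 : p / 2 < normc (1 - z^* * (h + z)).
  near: h; apply: (cvgr_gt _ (cvg_normc _ czz)); rewrite pE; lra.
have t2 : normc (hb_kernel b z (h + z)) < 2 * kdiag b z.
  near: h; apply: (cvgr_lt _ (cvg_normc _ hb_kernel_shift_cvg)).
  by rewrite hb_kernel_diag normc_real ?ltW //; lra.
move: s2 t2 q2; set s := normc (1 - _); set t := normc (hb_kernel _ _ _).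
set q := 1 - normc (h + z) ^+ 2; set k := kdiag b z.
set N := normc h ^+ 2; have N0 : 0 <= N by rewrite sqr_ge0.
set D := kdist2 _ _ _ => s2 t2 q2 le1.
have kp : 0 < k by [].
(* Replacing [q] by p / 2 in front of [D] requires [D] to be nonnegative, so the other sign is
   settled first. *)
have [D0|D0] := leP D 0.
  by apply: le_trans D0 _; rewrite mulr_ge0 // divr_ge0 ?sqr_ge0 // mulr_ge0 // ltW.
have {}le1 : p / 2 * D <= N * (2 * k + 2 * (3 * k / (p / 2))).
  apply: le_trans (ler_wpM2r (ltW D0) (ltW q2)) _.
  apply: le_trans le1 _; apply: ler_wpM2l => //; apply: lerD; first exact: ltW.
  apply: ler_wpM2l => //; rewrite ler_pdivrMr; last by lra.
  rewrite mulrAC ler_pdivlMr; last by lra.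
  nra.
rewrite mulrA ler_pdivlMr ?exprn_gt0 //.
have : p / 2 * D * p <= N * (2 * k + 2 * (3 * k / (p / 2))) * p.
  by apply: ler_wpM2r => //; exact: ltW.
(* As p <= 1, the factor 2 p + 12 is at most 14, whence D p^2 <= 28 N k. *)
rewrite (_ : N * (2 * k + 2 * (3 * k / (p / 2))) * p = N * k * (2 * p + 12)).
  have Nk0 : 0 <= N * k by rewrite mulr_ge0 // ltW.
  have := ler_wpM2l Nk0 p1; lra.
by field; lra.
Unshelve. all: by end_near. Qed.

(** Bounds derivative evaluation at [z] as a functional on H(b): divide [hb_norm_le_diff] by |h|,
    insert [near_kdist2_le] and let h tend to 0. *)
Lemma derivative_le f r (l : R[i]) : 0 < r -> hb_norm_le b f r ->
  (f (h + z) - f z) / h @[h --> (0 : R[i])^'] --> l ->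
  normc l * (1 - normc z ^+ 2) <= 6 * r * Num.sqrt (kdiag b z).
Proof.
move=> r0 fr fl; have z2 := disk_normc_sqr Dz; have k0 := kdiag_gt0 bD Dz.
have p0 : 0 < 1 - normc z ^+ 2 by rewrite subr_gt0.
rewrite -ler_pdivlMr //; apply: (normc_lim_le _ fl); near=> h.
have h0 : h != 0 by near: h; exact: nbhs_dnbhs_neq.
have [Dh le_d] : @disk R (h + z) /\ kdist2 b (h + z) z <=
    normc h ^+ 2 * (36 * kdiag b z / (1 - normc z ^+ 2) ^+ 2).
  by near: h; exact: (near_kdist2_le r0 fr).
have := hb_norm_le_diff fr Dh Dz.
move=> /le_trans/(_ (ler_wpM2l (sqr_ge0 r) le_d)) le1.
have nh0 : 0 < normc h by rewrite normc_gt0.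
rewrite normcM normcV ler_pdivrMr //.
rewrite -(@ler_pXn2r _ 2) ?nnegrE ?normc_ge0 //; last first.
  by rewrite !mulr_ge0 ?invr_ge0 ?normc_ge0 ?sqrtr_ge0 ?ltW.
apply: le_trans le1 _.
rewrite !exprMn sqr_sqrtr ?(ltW k0) // exprVn.
rewrite le_eqVlt; apply/orP; left; apply/eqP.
by field; rewrite gt_eqF.
Unshelve. all: by end_near. Qed.

Lemma cauchy_quotient_derivative (c d : R[i]) : 1 - d * z != 0 ->
  ((1 - c * b (h + z)) / (1 - d * (h + z)) - (1 - c * b z) / (1 - d * z)) / h
    @[h --> (0 : R[i])^'] -->
  (d * ((1 - c * b z) / (1 - d * z)) - 'D_1 b z * c) / (1 - d * z).
Proof.
move=> dz; set k := (1 - c * b z) / (1 - d * z).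
have cd : 1 - d * (h + z) @[h --> (0 : R[i])^'] --> 1 - d * z.
  apply: cvgB; first exact: cvg_cst.
  by apply: cvgM; [exact: cvg_cst|exact: cvg_dnbhs0_shift].
have lim : (d * k - (b (h + z) - b z) / h * c) / (1 - d * (h + z))
    @[h --> (0 : R[i])^'] --> (d * k - 'D_1 b z * c) / (1 - d * z).
  apply: cvgM; last exact: cvgV.
  apply: cvgB; first exact: cvg_cst.
  by apply: cvgM; [exact: derivable_quotient_cvg|exact: cvg_cst].
have cd' := (cvg_normcP _ _ _).1 cd.
apply: cvg_trans lim; apply: near_eq_cvg; near=> h.
have h0 : h != 0 by near: h; exact: nbhs_dnbhs_neq.
have dh : 1 - d * (h + z) != 0.
  near: h; have /cd' : 0 < normc (1 - d * z) by rewrite normc_gt0.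
  apply: filterS => h; apply: contraTneq => ->.
  by rewrite sub0r normcN ltxx.
rewrite cauchy_quotient_diff // -/k addrK.
by field; rewrite dh h0.
Unshelve. all: by end_near. Qed.

(** Schwarz-Pick divided by |h|. The factor 2 is slack that makes |k_z(h + z)| < 2 k_z(z) hold for
    small h. *)
Lemma derivative_le_kdiag f r : 0 < r -> hb_norm_le b f r ->
  normc ('D_1 b z) <= 2 * kdiag b z.
Proof.
move=> r0 fr; have k0 := kdiag_gt0 bD Dz.
apply: (normc_lim_le _ derivable_quotient_cvg); near=> h.
have h0 : h != 0 by near: h; exact: nbhs_dnbhs_neq.
have Dh : @disk R (h + z).
  apply/diskE; near: h; apply: (cvgr_lt _ (cvg_normc _ cvg_dnbhs0_shift)).
  exact/diskE.
have t2 : normc (hb_kernel b z (h + z)) < 2 * kdiag b z.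
  near: h; apply: (cvgr_lt _ (cvg_normc _ hb_kernel_shift_cvg)).
  by rewrite hb_kernel_diag normc_real ?ltW //; lra.
have := schwarz_pick bD r0 fr Dh Dz; rewrite addrK => sp.
have nh0 : 0 < normc h by rewrite normc_gt0.
rewrite normcM normcV ler_pdivrMr // mulrC.
by apply: le_trans sp _; rewrite ler_wpM2l ?normc_ge0 // ltW.
Unshelve. all: by end_near. Qed.

End DerivativeBound.

(** * Pointwise limits and boundedness of the kernels near 1 *)

Section BoundaryKernel.
Variables (R : realType) (b k1 : R[i] -> R[i]) (Om : set R[i]).
Local Notation F := (within Om (nbhs (1 : R[i]))).
Hypothesis bD : forall z, @disk R z -> @disk R (b z).
Hypothesis OmD : Om `<=` @disk R.
Hypothesis FF : ProperFilter F.
Hypothesis k1P : forall eps : R, 0 < eps ->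
  \forall z \near F, hb_norm_le b (fun w => hb_kernel b z w - k1 w) eps.

Lemma near_disk : \forall z \near F, @disk R z.
Proof. by apply: filterS (withinT Om _) => z /OmD. Qed.

Lemma cvg_boundary_id : z @[z --> F] --> (1 : R[i]).
Proof. exact: cvg_within. Qed.

Lemma disk_subr1_neq0 w : @disk R w -> 1 - w != 0.
Proof.
by move=> /diskE w1; apply: contraTneq w1 => /subr0_eq <-; rewrite normc1 ltxx.
Qed.

(** Point evaluation is bounded on H(b), so norm convergence implies pointwise convergence. *)
Lemma hb_kernel_cvg w : @disk R w -> hb_kernel b z w @[z --> F] --> k1 w.
Proof.
move=> Dw; apply/cvg_normcP => e e0; have k0 := kdiag_gt0 bD Dw.
(* As k < (1 + k)^2 for k = k_w(w), this tolerance keeps the squared error below e^2 without a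
   square root. *)
have d0 : 0 < e / (1 + kdiag b w) by rewrite divr_gt0 // addr_gt0.
apply: filterS (k1P d0) => z /hb_norm_le_eval /(_ Dw) le1.
rewrite -(@ltr_pXn2r _ 2) ?nnegrE ?normc_ge0 ?(ltW e0) //.
apply: le_lt_trans le1 _; rewrite expr_div_n mulrAC ltr_pdivrMr.
  by rewrite ltr_pM2l ?exprn_gt0 //; nra.
by rewrite exprn_gt0 // addr_gt0.
Qed.

Lemma hb_norm_le_sqrt f r w (M : R) : hb_norm_le b f r -> @disk R w ->
  kdiag b w <= M -> normc (f w) <= r * Num.sqrt M.
Proof.
move=> fr Dw kM; have := hb_norm_le_eval fr Dw; case: (fr) => r0 _ le1.
have M0 : 0 <= M by apply: le_trans kM; apply/ltW/kdiag_gt0.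
rewrite -(@ler_pXn2r _ 2) ?nnegrE ?normc_ge0 ?mulr_ge0 ?sqrtr_ge0 //.
rewrite exprMn sqr_sqrtr //; apply: le_trans le1 _.
by rewrite ler_wpM2l ?sqr_ge0.
Qed.

(** Fix [w] with |k_w - k1| <= 1. Evaluating k_z - k1 and k_w - k1 at z gives s^2 <= 2 s + B for s =
    |k_z|, where [B] bounds |k_w| on the disk; hence s stays bounded. *)
Lemma kdiag_bounded : exists2 M : R, 1 <= M & \forall z \near F, kdiag b z <= M.
Proof.
have [w [Pw Dw]] := filter_ex (filterI (k1P ltr01) near_disk).
have w1 := (diskE w).1 Dw.
set B := 2 / (1 - normc w).
have B0 : 0 < B by rewrite divr_gt0 ?subr_gt0.
exists (4 + 2 * B); first by lra.
near=> z.
have Dz : @disk R z by near: z; exact: near_disk.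
have Pz : hb_norm_le b (fun w => hb_kernel b z w - k1 w) 1.
  by near: z; exact: k1P.
have k0 := kdiag_gt0 bD Dz.
have := hb_norm_le_sqrt Pz Dz (lexx _); have := hb_norm_le_sqrt Pw Dz (lexx _).
rewrite !mul1r hb_kernel_diag.
have : normc (hb_kernel b w z) <= B.
  rewrite /hb_kernel normcM normcV.
  have n0 : 0 < normc (1 - w^* * z) by rewrite normc_gt0 disk_conj_neq0.
  have := (diskE _).1 (bD Dw); have := (diskE _).1 (bD Dz).
  have z1 := (diskE _).1 Dz.
  have := normc_ge0 (b w); have := normc_ge0 (b z).
  have := normc_ge0 w; have := normc_ge0 z.
  move=> z0 w0 bz0 bw0 bz1 bw1.
  have n1 : 1 - normc w <= normc (1 - w^* * z).
    have := normc_dist_split 1 (w^* * z) 0.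
    rewrite !subr0 normc1 normcM normc_conj; nra.
  have n2 : normc (1 - (b w)^* * b z) <= 2.
    apply: le_trans (normc_triangle _ _) _.
    by rewrite normc1 normcM normc_conj; nra.
  apply: ler_pM => //; rewrite ?normc_ge0 ?invr_ge0 ?normc_ge0 //.
  by rewrite lef_pV2 ?posrE ?subr_gt0.
have := normc_dist_split (kdiag b z)%:C%C (k1 z) 0.
have := normc_dist_split (k1 z) (hb_kernel b w z) 0.
rewrite !subr0 normc_real ?(ltW k0) // (normcB (k1 z) (hb_kernel b w z)).
have := sqr_sqrtr (ltW k0); set s := Num.sqrt _ => sE h1 h2 h3 h4 h5.
have : kdiag b z <= 2 * s + B by lra.
(* The square gives 2 s <= s^2 / 2 + 2, hence s^2 <= 4 + 2 B. *)
have := sqr_ge0 (s - 2); nra.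
Unshelve. all: by end_near. Qed.

Lemma one_sub_normc_sqr_le z : @disk R z ->
  1 - normc z ^+ 2 <= 2 * normc (1 - z).
Proof.
move=> /diskE z1; have := normc_dist_split 1 z 0; rewrite !subr0 normc1.
by have := normc_ge0 z; nra.
Qed.

(** 1 - |b(z)|^2 is k_z(z) (1 - |z|^2), a bounded factor times one that tends to 0. *)
Lemma normc_b_cvg1 e : 0 < e -> \forall z \near F, 1 - e < normc (b z).
Proof.
move=> e0; have [M M1 kM] := kdiag_bounded.
have d0 : 0 < e / (2 * M) by rewrite divr_gt0 // mulr_gt0 //; lra.
near=> z.
have Dz : @disk R z by near: z; exact: near_disk.
have kz : kdiag b z <= M by near: z.
have z1 : normc (z - 1) < e / (2 * M).
  near: z; have /cvg_normcP := cvg_boundary_id; exact.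
have := one_sub_normc_sqr_le Dz; rewrite normcB => le1.
move: kz; rewrite /kdiag ler_pdivrMr ?subr_gt0 ?disk_normc_sqr // => le2.
have : 1 - normc (b z) ^+ 2 < e.
  apply: le_lt_trans le2 _.
  apply: le_lt_trans (ler_wpM2l _ le1) _; first by lra.
  by move: z1; rewrite ltr_pdivlMr ?mulr_gt0 //; lra.
have := (diskE _).1 (bD Dz); have := normc_ge0 (b z); nra.
Unshelve. all: by end_near. Qed.

(** * Boundary value of b and the formula for the boundary kernel *)

(** At a point [w] with b(w) nonzero, k_z(w) determines conj b(z), so its convergence passes to
    b(z). Such a [w] exists because |b| tends to 1, which also forces |b1| = 1. *)
Lemma b_cvg : exists2 b1 : R[i], b z @[z --> F] --> b1 & normc b1 = 1.
Proof.
have half0 : 0 < 2^-1 :> R by rewrite invr_gt0.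
have [w [bw Dw]] := filter_ex (filterI (normc_b_cvg1 half0) near_disk).
have bw0 : b w != 0 by rewrite -normc_gt0; lra.
set c := (1 - k1 w * (1 - 1^* * w)) / b w.
have cvgc : (b z)^* @[z --> F] --> c.
  have lim : (1 - hb_kernel b z w * (1 - z^* * w)) / b w @[z --> F] --> c.
    apply: cvgM; last exact: cvg_cst.
    apply: cvgB; first exact: cvg_cst.
    apply: cvgM; first exact: hb_kernel_cvg.
    apply: cvgB; first exact: cvg_cst.
    apply: cvgM; last exact: cvg_cst.
    by apply: cvg_conj; exact: cvg_boundary_id.
  apply: cvg_trans lim; apply: near_eq_cvg; near=> z.
  have Dz : @disk R z by near: z; exact: near_disk.
  by rewrite divfK ?disk_conj_neq0 // opprB addrC subrK mulfK.
have cvgb : b z @[z --> F] --> c^*.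
  apply: cvg_trans (cvg_conj _ cvgc); apply: near_eq_cvg.
  by apply: nearW => z; rewrite conjCK.
exists c^* => //; apply/eqP; rewrite eq_le; apply/andP; split.
  apply: (normc_lim_le _ cvgb); apply: filterS near_disk => z /bD /diskE.
  exact: ltW.
rewrite leNgt; apply/negP => c1.
have e0 : 0 < (1 - normc c^*) / 2 by rewrite divr_gt0 // subr_gt0.
have c2 : normc c^* < 1 - (1 - normc c^*) / 2 by lra.
have := filter_ex (filterI (normc_b_cvg1 e0) (cvgr_lt _ (cvg_normc _ cvgb) _ c2)).
by case=> z []; lra.
Unshelve. all: by end_near. Qed.

Lemma k1E (b1 w : R[i]) : b z @[z --> F] --> b1 -> @disk R w ->
  k1 w = (1 - b1^* * b w) / (1 - w).
Proof.
move=> cb Dw; apply: (norm_cvg_unique (F := hb_kernel b z w @[z --> F])).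
  exact: hb_kernel_cvg.
have -> : (1 - b1^* * b w) / (1 - w) = (1 - b1^* * b w) / (1 - 1^* * w).
  by rewrite conjC1 mul1r.
apply: cvgM.
  apply: cvgB; first exact: cvg_cst.
  by apply: cvgM; [exact: cvg_conj|exact: cvg_cst].
apply: cvgV; first by rewrite conjC1 mul1r disk_subr1_neq0.
apply: cvgB; first exact: cvg_cst.
apply: cvgM; last exact: cvg_cst.
by apply: cvg_conj; exact: cvg_boundary_id.
Qed.

(** * Limits of the kernel norms and of the derivative *)

(** The squared norms are shown to be Cauchy from values alone: k_w(w) and k_z(z) are joined through
    k1(w), k_z(w) and k1(z), in four steps each less than e / 4. *)
Lemma kdiag_cvg : exists kap : R,
  kdiag b z @[z --> F] --> kap /\ k1 z @[z --> F] --> kap%:C%C.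
Proof.
have [M M1 kM] := kdiag_bounded.
have sM : 0 < Num.sqrt M by rewrite sqrtr_gt0; lra.
have near_pair e : 0 < e -> \forall z \near F, [/\ @disk R z, kdiag b z <= M &
    forall w, @disk R w -> kdiag b w <= M -> normc (hb_kernel b z w - k1 w) < e].
  move=> e0; have d0 : 0 < e / (2 * Num.sqrt M) by rewrite divr_gt0 // mulr_gt0.
  near=> z; split; [by near: z; exact: near_disk|by near: z|] => w Dw kw.
  have Pz : hb_norm_le b (fun w => hb_kernel b z w - k1 w) (e / (2 * Num.sqrt M)).
    by near: z; exact: k1P.
  apply: le_lt_trans (hb_norm_le_sqrt Pz Dw kw) _.
  rewrite [ltLHS](_ : _ = e / 2); first by lra.
  by field; rewrite gt_eqF.
have cauchy_k : cauchy (kdiag b z @[z --> F]).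
  apply: cauchy_exP => e e0; have e4 : 0 < e / 4 by rewrite divr_gt0.
  have [w [Dw kw Pw]] := filter_ex (near_pair _ e4).
  exists (kdiag b w); apply: filterS (near_pair _ e4) => z [Dz kz Pz].
  rewrite /ball /= -normc_realc rmorphB.
  apply: le_lt_trans (normc_dist_split _ (k1 w) _) _.
  have := Pw w Dw kw; have := Pz z Dz kz; have := Pw z Dz kz; have := Pz w Dw kw.
  rewrite !hb_kernel_diag => h1 h2 h3 h4.
  have := normc_dist_split (k1 w) (hb_kernel b z w) (kdiag b z)%:C%C.
  (* Hermitian symmetry and the reality of k_z(z) exchange k_z(w) for k_w(z) inside the chain. *)
  have : normc (hb_kernel b z w - (kdiag b z)%:C%C) =
      normc (hb_kernel b w z - (kdiag b z)%:C%C).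
    rewrite -(hb_kernelC b z w) -normc_conj rmorphB /=.
    by congr (normc (_ - _)); exact: conjc_real.
  have := normc_dist_split (hb_kernel b w z) (k1 z) (kdiag b z)%:C%C.
  rewrite (normcB (k1 z) (kdiag b z)%:C%C) (normcB (k1 w) (hb_kernel b z w)).
  lra.
have /cauchy_cvgP/cvg_ex[kap ck] := cauchy_k.
exists kap; split => //; apply/cvg_normcP => e e0.
have e2 : 0 < e / 2 by rewrite divr_gt0.
have /cvgrPdist_lt /(_ _ e2) ck' := ck.
near=> z.
have [Dz kz /(_ _ Dz kz)] : [/\ @disk R z, kdiag b z <= M &
    forall w, @disk R w -> kdiag b w <= M ->
      normc (hb_kernel b z w - k1 w) < e / 2] by near: z; exact: near_pair.
have : `|kap - kdiag b z| < e / 2 by near: z.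
rewrite hb_kernel_diag => h1 h2.
apply: le_lt_trans (normc_dist_split _ (kdiag b z)%:C%C _) _.
rewrite -rmorphB normc_realc distrC normcB; lra.
Unshelve. all: by end_near. Qed.

(* With p := 1 - |z|^2 and X := kap - b'(z) conj b1, the derivative of
   [k_z - k1] at [z], times p, is X (1 - p / (1 - z)) up to vanishing errors,
   and |1 - p / (1 - z)| = |z|. *)
Lemma derivative_estimate z r (b1 : R[i]) (kap M : R) :
  @disk R z -> derivable b z 1 -> b w @[w --> F] --> b1 ->
  0 < r -> hb_norm_le b (fun w => hb_kernel b z w - k1 w) r ->
  kdiag b z <= M ->
  normc (kap%:C%C - 'D_1 b z * b1^*) * normc z <=
  6 * r * Num.sqrt M + normc (z^* * (kdiag b z)%:C%C - kap%:C%C) +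
  2 * M * normc (b z - b1) + 2 * normc (k1 z - kap%:C%C).
Proof.
move=> Dz dbz cb r0 Pz kM; set d := 'D_1 b z.
have z10 := disk_subr1_neq0 Dz; have p0 := disk_conj_neq0 Dz Dz.
(* The derivative of k_z - k1 at [z], with the quotient for the boundary kernel folded back into
   k1(z). *)
pose l := (z^* * hb_kernel b z z - d * (b z)^*) / (1 - z^* * z) -
          (k1 z - d * b1^*) / (1 - z).
have cl : (hb_kernel b z (h + z) - k1 (h + z) - (hb_kernel b z z - k1 z)) / h
    @[h --> (0 : R[i])^'] --> l.
  have lim1 := cauchy_quotient_derivative (c := (b z)^*) dbz p0.
  have p1 : 1 - 1 * z != 0 by rewrite mul1r.
  have lim2 := cauchy_quotient_derivative (c := b1^*) dbz p1.
  have lE : l = (z^* * hb_kernel b z z - d * (b z)^*) / (1 - z^* * z) -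
      (1 * ((1 - b1^* * b z) / (1 - 1 * z)) - d * b1^*) / (1 - 1 * z).
    by rewrite /l (k1E cb Dz) !mul1r.
  rewrite lE; apply: cvg_trans (cvgB lim1 lim2).
  apply: near_eq_cvg; near=> h.
  have Dh : @disk R (h + z).
    apply/diskE; near: h.
    by apply: (cvgr_lt _ (cvg_normc _ (@cvg_dnbhs0_shift R z))); exact/diskE.
  by rewrite (k1E cb Dh) (k1E cb Dz) /hb_kernel ?fctE /= !mul1r; ring.
have le1 := derivative_le bD dbz Dz r0 Pz cl.
have {}le1 : normc l * (1 - normc z ^+ 2) <= 6 * r * Num.sqrt M.
  apply: le_trans le1 _; rewrite ler_wpM2l ?mulr_ge0 ?(ltW r0) //.
  by rewrite ler_wsqrtr.
have pE : 1 - z^* * z = (1 - normc z ^+ 2)%:C%C.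
  by rewrite rmorphB /= normc_sqr mulrC.
have pp : 0 < 1 - normc z ^+ 2 by rewrite subr_gt0 disk_normc_sqr.
set X := kap%:C%C - _.
(* Both numerators of [l] are close to [X]: they are X + e1 and X + (k1(z) - kap). The factor p / |1
   - z| in [e2] is at most 2. *)
pose e1 := z^* * hb_kernel b z z - kap%:C%C - d * (b z - b1)^*.
pose e2 := (k1 z - kap%:C%C) * ((1 - z^* * z) / (1 - z)).
(* Here 1 - p / (1 - z) = - z conj(1 - z) / (1 - z), where the quotient of conjugates has modulus 1
   for every [z] in the disk. *)
have XE : X * (- z * ((1 - z)^* / (1 - z))) = l * (1 - z^* * z) - e1 + e2.
  rewrite /l /e1 /e2 /X !rmorphB rmorph1 /=.
  by field; rewrite z10 p0.
have nz : normc ((1 - z)^* / (1 - z)) = 1.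
  by rewrite normcM normcV normc_conj divff // gt_eqF // normc_gt0.
have -> : normc X * normc z = normc (l * (1 - z^* * z) - e1 + e2).
  by rewrite -XE 2!normcM nz normcN mulr1.
apply: le_trans (le_normcD _ _) _; apply: lerD; last first.
  rewrite /e2 normcM mulrC ler_wpM2r ?normc_ge0 //.
  rewrite normcM normcV pE normc_real ?(ltW pp) // ler_pdivrMr ?normc_gt0 //.
  exact: one_sub_normc_sqr_le.
apply: le_trans (normc_triangle _ _) _; rewrite -addrA; apply: lerD.
  by rewrite normcM pE normc_real // ltW.
apply: le_trans (normc_triangle _ _) _; rewrite hb_kernel_diag; apply: lerD => //.
rewrite normcM normc_conj ler_wpM2r ?normc_ge0 //.
apply: le_trans (derivative_le_kdiag bD dbz Dz r0 Pz) _.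
by rewrite ler_wpM2l.
Unshelve. all: by end_near. Qed.

(** [derivative_estimate] makes kap - b'(z) conj b1 small; multiplying by b1, of modulus 1, turns
    this into the distance from b'(z) to kap b1. *)
Lemma derivative_cvg (b1 : R[i]) (kap : R) :
  holomorphic_on b (@disk R) ->
  b z @[z --> F] --> b1 -> normc b1 = 1 ->
  kdiag b z @[z --> F] --> kap -> k1 z @[z --> F] --> kap%:C%C ->
  'D_1 b z @[z --> F] --> kap%:C%C * b1.
Proof.
move=> hol cb nb1 ck ck1; have [M M1 kM] := kdiag_bounded.
(* With every error below [dl], and sqrt M and 1 at most [M], the estimate sums to at most 11 M dl;
   dividing by |z| > 1/2 gives 22 M dl < e. *)
apply/cvg_normcP => e e0; pose dl := e / (23 * M).
have dl0 : 0 < dl by rewrite divr_gt0 // mulr_gt0 //; lra.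
have ckC : (kdiag b z)%:C%C @[z --> F] --> kap%:C%C.
  apply/cvg_normcP => e' e'0; have /cvgrPdist_lt /(_ _ e'0) := ck.
  by apply: filterS => z; rewrite -rmorphB normc_realc distrC.
have cz : z^* * (kdiag b z)%:C%C @[z --> F] --> 1^* * kap%:C%C.
  exact: (cvgM (cvg_conj _ cvg_boundary_id) ckC).
rewrite conjC1 mul1r in cz.
have half1 : 2^-1 < normc (1 : R[i]) by rewrite normc1; lra.
have /cvg_normcP /(_ _ dl0) cz' := cz.
have /cvg_normcP /(_ _ dl0) cb' := cb.
have /cvg_normcP /(_ _ dl0) ck1' := ck1.
near=> z.
have Dz : @disk R z by near: z; exact: near_disk.
have kz : kdiag b z <= M by near: z.
have Pz : hb_norm_le b (fun w => hb_kernel b z w - k1 w) dl.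
  by near: z; exact: k1P.
have := derivative_estimate kap Dz (hol _ Dz) cb dl0 Pz kz.
have n1 : normc (z^* * (kdiag b z)%:C%C - kap%:C%C) < dl by near: z.
have n2 : normc (b z - b1) < dl by near: z.
have n3 : normc (k1 z - kap%:C%C) < dl by near: z.
have z2 : 2^-1 < normc z.
  by near: z; exact: (cvgr_gt _ (cvg_normc _ cvg_boundary_id)).
have b1J : b1^* * b1 = 1.
  by rewrite mulrC -normc_sqr nb1 expr1n.
have -> : 'D_1 b z - kap%:C%C * b1 = - ((kap%:C%C - 'D_1 b z * b1^*) * b1).
  by rewrite mulrBl -mulrA b1J mulr1 opprB.
rewrite normcN normcM nb1 mulr1.
have X0 := normc_ge0 (kap%:C%C - 'D_1 b z * b1^*).
move: X0; set X := normc (kap%:C%C - _) => X0 le1.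
have sM : Num.sqrt M <= M.
  rewrite -(@ler_pXn2r _ 2) ?nnegrE ?sqrtr_ge0 //; last by lra.
  by rewrite sqr_sqrtr; nra.
have dE : e = 23 * M * dl by rewrite /dl mulrC divfK // gt_eqF // mulr_gt0 //; lra.
have le2 : X * 2^-1 <= X * normc z by rewrite ler_wpM2l // ltW.
have le3 : 6 * dl * Num.sqrt M <= 6 * dl * M by rewrite ler_wpM2l // mulr_ge0 // ltW.
have le4 : 2 * M * normc (b z - b1) <= 2 * M * dl.
  by rewrite ler_wpM2l ?(ltW n2) // mulr_ge0 //; lra.
have le5 : dl <= M * dl by rewrite ler_peMl // ltW.
rewrite dE; lra.
Unshelve. all: by end_near. Qed.

End BoundaryKernel.

(** * Boundary limits in an approach region *)

Theorem theoremD (R : realType) (b : R[i] -> R[i]) (Om : set R[i]) :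
  holomorphic_on b (@disk R) ->
  (forall z, @disk R z -> @disk R (b z)) ->
  approach_region Om ->
  (exists k1 : R[i] -> R[i],
     forall eps : R, 0 < eps ->
       \forall z \near within Om (nbhs (1 : R[i])),
         hb_norm_le b (fun w => hb_kernel b z w - k1 w) eps) ->
  exists b1 db1 : R[i],
    [/\ b z @[z --> within Om (nbhs (1 : R[i]))] --> b1,
        'D_1 b z @[z --> within Om (nbhs (1 : R[i]))] --> db1 &
        `|b1| = 1].
Proof.
move=> hol bD [_ OmD _ bdOm _] [k1 k1P].
(* The boundary condition puts 1 in the closure of [Om], which makes the filter of approach within
   [Om] proper. *)
have cl1 : closure Om 1.
  have : [set 1 : R[i]] 1 by [].
  by rewrite -bdOm => -[[]].
have FF := within_nbhs_proper cl1.
have [b1 cb nb1] := b_cvg bD OmD FF k1P.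
have [kap [ck ck1]] := kdiag_cvg bD OmD FF k1P.
exists b1, (kap%:C%C * b1); split; first exact: cb.
  exact: (derivative_cvg bD OmD FF k1P hol cb nb1 ck ck1).
by rewrite -[LHS]/((normc b1)%:C%C) nb1.
Qed.
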